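(* Let $a,b$ be two variables and let $n\ge 3$ be an integer. Let $S=(S_{ij})_{1\le i,j\le n}$ be the $n\times n$ matrix $$S=\left(\begin{array}{cccccc} a+b & (-1)^{n+1}a & 0 & \cdots & 0 & b\\ (-1)^{n+1}b & a+b & a & \cdots & 0 & 0\\ 0 & b & a+b & \cdots & 0 & 0\\ \vdots & \vdots & \vdots & \ddots & \vdots & \vdots\\ 0 & 0 & 0 & \cdots & a+b & a\\ a & 0 & 0 & \cdots & b & a+b \end{array}\right),$$ that is, $S_{ii}=a+b$ for $1\le i\le n$; $S_{12}=(-1)^{n+1}a$ and $S_{21}=(-1)^{n+1}b$; $S_{i,i+1}=a$ and $S_{i+1,i}=b$ for $2\le i\le n-1$; $S_{1n}=b$ and $S_{n1}=a$; and all other entries are $0$. Then $$\det(S)=2(a^n+b^n).$$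
   Context: The variables $a,b$ are commuting indeterminates, and the identity is one of polynomials in $a$ and $b$. *)

(* Defs.v *)
From mathcomp Require Import all_boot all_algebra.

Set Implicit Arguments.
Unset Strict Implicit.
Unset Printing Implicit Defensive.

Import GRing.Theory.

Local Open Scope ring_scope.

(* Indices start from 0, so the 1-based entry (i, j) is (i - 1, j - 1) here.
   The signed entries (0, 1) and (1, 0) must be tested before the generic
   super- and subdiagonal ones.  For n >= 3 the two corners (0, n - 1) and
   (n - 1, 0) lie outside the three diagonals. *)
Definition S_entry (R : comNzRingType) (n : nat) (a b : R) (i j : nat) : R :=
  if i == j then a + b
  else if (i == 0%N) && (j == 1%N) then (-1) ^+ n.+1 * a
  else if (i == 1%N) && (j == 0%N) then (-1) ^+ n.+1 * b
  else if j == i.+1 then a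
  else if i == j.+1 then b
  else if (i == 0%N) && (j == n.-1) then b
  else if (i == n.-1) && (j == 0%N) then a
  else 0.

Definition S_mx (R : comNzRingType) (n : nat) (a b : R) : 'M[R]_n :=
  \matrix_(i < n, j < n) S_entry n a b i j.

(* Main.v *)
Require Import Defs.
From mathcomp Require Import all_boot all_algebra mpoly.
From mathcomp Require Import ring zify.

Set Implicit Arguments.
Unset Strict Implicit.
Unset Printing Implicit Defensive.

Import GRing.Theory.

Local Open Scope ring_scope.

(** The matrix factors.  Let [P] be the cyclic shift matrix, with a one in each
    position [(i, i + 1)] modulo [n], whose row [0] is multiplied by
    [(-1) ^ (n + 1)].  Its columns are orthonormal, i.e. [P^T P = 1], and
    comparing entries gives, for [n >= 3],
      [S = (a + b) 1 + a P + b P^T = (a 1 + b P)^T (1 + P)].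
    For a cyclic shift [W] with weights [d_i], the matrix [x 1 + W] has only two
    permutations contributing to its determinant: the identity, giving [x ^ n],
    and the full [n]-cycle, giving [(-1) ^ (n - 1)] times the product of the
    [d_i].  The sign put in row [0] of [P] cancels the sign of the [n]-cycle, so
    [det (x 1 + y P) = x ^ n + y ^ n]; the two factors of [S] thus have
    determinants [a ^ n + b ^ n] and [2].  The argument is valid for any two
    elements of a commutative ring. *)

Section CyclicShift.
Variable R : comNzRingType.

Definition weighted_shift n (d : 'I_n -> R) : 'M[R]_n :=
  \matrix_(i, j) (d i *+ (j == ordS i)).

Lemma weighted_shiftZ n (y : R) (d : 'I_n -> R) :
  y *: weighted_shift d = weighted_shift (fun i => y * d i).
Proof. by apply/matrixP => i j; rewrite !mxE mulrnAr. Qed.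

(** Column [0] is [x e_0 + d_max e_max].  Deleting it together with row [0]
    leaves an upper triangular matrix with diagonal [x]; deleting it together
    with the last row leaves a lower triangular one whose diagonal consists of
    the remaining weights. *)
Lemma det_scalar_add_weighted_shift m (x : R) (d : 'I_m.+1 -> R) :
  \det (x%:M + weighted_shift d) = x ^+ m.+1 + (-1) ^+ m * \prod_i d i.
Proof.
set A := _ + _.
have entryA i j : A i j = x *+ (i == j) + d i *+ (j == ordS i) by rewrite !mxE.
have col0A i : A i ord0 = x *+ (i == ord0) + d i *+ (i == ord_max).
  rewrite entryA; congr (_ + _ *+ nat_of_bool _).
  rewrite -!val_eqE /=; have := ltn_ord i.
  rewrite ltnS leq_eqVlt => /predU1P[->|lt_im]; first by rewrite modnn !eqxx.
  by rewrite modn_small ?ltnS // (ltn_eqF lt_im).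
have minor0 : \det (row' ord0 (col' ord0 A)) = x ^+ m.
  rewrite -det_tr det_trig.
    rewrite -[m in RHS]card_ord -prodr_const; apply: eq_bigr => i _.
    rewrite !mxE eqxx -val_eqE /= /bump /= add1n.
    have := ltn_ord i; rewrite leq_eqVlt => /predU1P[i_last|lt_im].
      by rewrite (_ : i.+2 %% _ = 0)%N ?addr0 // i_last modnn.
    by rewrite modn_small ?ltnS // eqSS ltn_eqF // addr0.
  apply/is_trig_mxP => i j lt_ij; rewrite !mxE -!val_eqE /= /bump /= !add1n.
  rewrite eqSS gtn_eqF //= add0r.
  have := ltn_ord j; rewrite leq_eqVlt => /predU1P[j_last|lt_jm].
    by rewrite (_ : j.+2 %% _ = 0)%N // j_last modnn.
  by rewrite modn_small ?ltnS // eqSS ltn_eqF // ltnW.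
have minor_max : \det (row' ord_max (col' ord0 A))
    = \prod_(i < m) d (widen_ord (leqnSn m) i).
  have lift_maxE (i : 'I_m) : lift ord_max i = widen_ord (leqnSn m) i.
    by apply: val_inj; exact: lift_max.
  rewrite det_trig.
    apply: eq_bigr => i _; rewrite !mxE lift_maxE -!val_eqE /= /bump /= add1n.
    by rewrite modn_small ?ltnS // eqxx ltn_eqF // add0r.
  apply/is_trig_mxP => i j lt_ij.
  rewrite !mxE lift_maxE -!val_eqE /= /bump /= add1n modn_small ?ltnS //.
  by rewrite eqSS (gtn_eqF lt_ij) ltn_eqF ?addr0 // ltnW.
rewrite (expand_det_col A ord0).
under [LHS]eq_bigr => i _ do rewrite col0A mulrDl !mulrnAl !mulrb.
rewrite big_split /= -!big_mkcond /= !big_pred1_eq /cofactor minor0 minor_max /=.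
by rewrite !addn0 mul1r -exprS big_ord_recr /= mulrCA [d _ * _]mulrC.
Qed.

Lemma trmx_weighted_shift_mul n (d : 'I_n -> R) :
  (forall i, d i * d i = 1) ->
  (weighted_shift d)^T *m weighted_shift d = 1%:M.
Proof.
move=> d2; apply/matrixP => i j; rewrite !mxE (bigD1 (ord_pred i)) //=.
rewrite !mxE ord_predK eqxx mulrnAr d2 eq_sym big1 ?addr0 // => k ne_k.
rewrite !mxE; case: eqP => [ik|_]; last by rewrite mul0r.
by rewrite ik ordSK eqxx in ne_k.
Qed.

Definition shift_sign n (i : 'I_n) : R :=
  if val i == 0%N then (-1) ^+ n.+1 else 1.

Lemma det_scalar_add_signed_shift n (x y : R) : (0 < n)%N ->
  \det (x%:M + y *: weighted_shift (@shift_sign n)) = x ^+ n + y ^+ n.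
Proof.
case: n => // m _; rewrite weighted_shiftZ det_scalar_add_weighted_shift.
rewrite big_split /= prodr_const card_ord big_ord_recl big1 // mulr1.
rewrite /shift_sign /= !exprS !mulN1r opprK mulrCA.
by rewrite -expr2 -exprM mulnC exprM sqrrN !expr1n mulr1.
Qed.

(** For [n >= 3] the positions [(i, i + 1)] and [(i + 1, i)] modulo [n] are all
    distinct, so that no two contributions add up in one entry of [S]. *)
Lemma S_mx_eq_shifts n (a b : R) : (3 <= n)%N ->
  let P := weighted_shift (@shift_sign n) in
  S_mx n a b = (a + b)%:M + a *: P + b *: P^T.
Proof.
move=> n3 P; apply/matrixP => i j; rewrite !mxE /shift_sign -!val_eqE /=.
rewrite /S_entry.
have eq_ordS (k l : 'I_n) :
    (l == (k.+1 %% n)%N :> nat)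
      = (l == k.+1 :> nat) || (k == n.-1 :> nat) && (l == 0%N :> nat).
  have [lt_k lt_l] := (ltn_ord k, ltn_ord l).
  have [k_last|k_small] := eqVneq (k : nat) n.-1.
    have ->: (k.+1 %% n = 0)%N by rewrite k_last prednK ?modnn //; lia.
    by rewrite orb_idl // => /eqP; lia.
  by rewrite modn_small ?orbF //; lia.
rewrite !eq_ordS; move: (ltn_ord i) (ltn_ord j).
move: (i : nat) (j : nat) => {}i {}j lt_in lt_jn.
(* Both sides now depend only on equalities between [i], [j] and constants. *)
repeat (case: eqP => /= ?; try by exfalso; lia).
all: by ring.
Qed.

Lemma det_S_mx n (a b : R) : (3 <= n)%N ->
  \det (S_mx n a b) = 2%:R * (a ^+ n + b ^+ n).
Proof.
move=> n3; have n_gt0 : (0 < n)%N by apply: leq_trans n3.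
pose P := weighted_shift (@shift_sign n).
have PTP : P^T *m P = 1%:M.
  apply: trmx_weighted_shift_mul => i; rewrite /shift_sign.
  by case: eqP => _; rewrite ?mul1r // -expr2 -exprM mulnC exprM sqrrN !expr1n.
have -> : S_mx n a b = (a%:M + b *: P)^T *m (1%:M + 1 *: P).
  rewrite S_mx_eq_shifts // scale1r -/P.
  have -> : (a%:M + b *: P)^T = a%:M + b *: P^T.
    by rewrite raddfD /= tr_scalar_mx [(b *: P)^T]linearZ.
  rewrite mulmxDr mulmx1 mulmxDl mul_scalar_mx -scalemxAl PTP scalemx1.
  rewrite raddfD /= -!addrA; congr (_ + _).
  by rewrite addrCA [RHS]addrCA [b%:M + _]addrC.
by rewrite det_mulmx det_tr !det_scalar_add_signed_shift // !expr1n mulrC.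
Qed.

End CyclicShift.

Theorem theorem4p1 (R : comNzRingType) (n : nat) (hn : (3 <= n)%N) :
  let a : {mpoly R[2]} := 'X_ord0 in
  let b : {mpoly R[2]} := 'X_ord_max in
  \det (S_mx n a b) = 2%:R * (a ^+ n + b ^+ n).
Proof. by move=> a b; exact: det_S_mx. Qed.
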